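(* Every locally precompact Hausdorff topological Abelian group belongs to the class $S_{TG}(\mathbb{T})$.
   Context: $\mathbb{T}$ denotes the unit circle of $\mathbb{C}$ with its usual topology and multiplication. A twisted sum of topological Abelian groups is a short exact sequence $0\to Y\stackrel{\imath}{\to} X\stackrel{\pi}{\to} Z\to 0$ of topological Abelian groups and continuous homomorphisms in which $\imath$ and $\pi$ are open onto their images. It splits if there is a continuous homomorphism $\Phi:X\to Y\times Z$ such that $\Phi\circ\imath$ is the canonical inclusion $y\mapsto (y,0)$ and $\pi_Z\circ\Phi=\pi$, where $\pi_Z:Y\times Z\to Z$ is the projection (such $\Phi$ is necessarily a topological isomorphism). A topological Abelian group $G$ belongs to $S_{TG}(\mathbb{T})$ if every twisted sum of topological Abelian groups $0\to\mathbb{T}\to X\to G\to 0$ splits. A Hausdorff topological Abelian group is locally precompact if it has a neighborhood $U$ of $0$ which is precompact, i.e. for every neighborhood $V$ of $0$ there is a finite set $F\subseteq G$ with $U\subseteq F+V$; equivalently, if it is (topologically isomorphic to) a subgroup of a locally compact group. *)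

(* Defs.v *)
From HB Require Import structures.
From mathcomp Require Import all_boot all_order all_algebra.
From mathcomp Require Import all_classical reals.
From mathcomp Require Import topology normedtype.
From mathcomp Require Import complex.

Set Implicit Arguments.
Unset Strict Implicit.
Unset Printing Implicit Defensive.

Import Order.TTheory GRing.Theory Num.Theory.
Import numFieldNormedType.Exports.

Local Open Scope classical_set_scope.
Local Open Scope ring_scope.

(* The unit circle of R[i].  Topological Abelian groups are written additively
   (topologicalZmodType), so the "+" of [circle R] is complex multiplication,
   its "0" is the complex number 1 and its "-" is complex inversion.  The
   regular algebra (complex R)^o gives access to the topology that the modulus
   defines on R[i]; the circle gets the induced topology. *)
Record circle (R : realType) := Circle {
  circle_val : (complex R)^o;
  circle_norm1 : `|circle_val| == 1
}.

HB.instance Definition _ (R : realType) := [isSub for @circle_val R].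
HB.instance Definition _ (R : realType) := [Choice of circle R by <:].

Section CircleGroup.
Variable R : realType.
Implicit Types z w : circle R.

Fact circle_one_subproof : `|1 : complex R| == 1.
Proof. by rewrite normr1. Qed.

Fact circle_mul_subproof z w : `|circle_val z * circle_val w| == 1.
Proof.
by rewrite normrM (eqP (circle_norm1 z)) (eqP (circle_norm1 w)) mulr1.
Qed.

Fact circle_inv_subproof z : `|(circle_val z)^-1| == 1.
Proof. by rewrite normfV (eqP (circle_norm1 z)) invr1. Qed.

Fact circle_val_neq0 z : circle_val z != 0.
Proof. by rewrite -normr_eq0 (eqP (circle_norm1 z)) oner_eq0. Qed.

Definition circle_one : circle R := Circle circle_one_subproof.
Definition circle_mul z w : circle R := Circle (circle_mul_subproof z w).
Definition circle_inv z : circle R := Circle (circle_inv_subproof z).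

Fact circle_mulA : associative circle_mul.
Proof. by move=> x y z; apply: val_inj; rewrite /= mulrA. Qed.

Fact circle_mulC : commutative circle_mul.
Proof. by move=> x y; apply: val_inj; rewrite /= mulrC. Qed.

Fact circle_mul1 : left_id circle_one circle_mul.
Proof. by move=> x; apply: val_inj; rewrite /= mul1r. Qed.

Fact circle_mulV : left_inverse circle_one circle_inv circle_mul.
Proof.
by move=> x; apply: val_inj; rewrite /= mulVf // circle_val_neq0.
Qed.

HB.instance Definition _ := GRing.isZmodule.Build (circle R)
  circle_mulA circle_mulC circle_mul1 circle_mulV.

Lemma circle_valD z w :
  circle_val (z + w) = circle_val z * circle_val w :> complex R.
Proof. by []. Qed.

Lemma circle_val0 : circle_val (0 : circle R) = 1 :> complex R.
Proof. by []. Qed.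

Lemma circle_valN z : circle_val (- z) = (circle_val z)^-1 :> complex R.
Proof. by []. Qed.

HB.instance Definition _ :=
  Topological.copy (circle R) (initial_topology (@circle_val R)).

Lemma circle_val_continuous : continuous (@circle_val R).
Proof. exact: (@initial_continuous _ _ (@circle_val R)). Qed.

Lemma continuous_circle (T : topologicalType) (f : T -> circle R) :
  continuous (@circle_val R \o f) -> continuous f.
Proof. by move=> cf; exact: (continuous_comp_initial cf). Qed.

Fact circle_add_continuous :
  continuous (fun x : circle R * circle R => x.1 + x.2).
Proof.
apply: continuous_circle => x; rewrite /=.
apply: (@cvgM (complex R)).
  by apply: continuous_comp; [exact: cvg_fst|exact: circle_val_continuous].
by apply: continuous_comp; [exact: cvg_snd|exact: circle_val_continuous].
Qed.

HB.instance Definition _ :=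
  PreTopologicalNmodule_isTopologicalNmodule.Build (circle R)
    circle_add_continuous.

Fact circle_opp_continuous : continuous (-%R : circle R -> circle R).
Proof.
apply: continuous_circle => x; rewrite /=.
apply: (@cvgV (complex R) _ (nbhs x)).
  exact: circle_val_neq0.
exact: circle_val_continuous.
Qed.

HB.instance Definition _ :=
  TopologicalNmodule_isTopologicalZmodule.Build (circle R)
    circle_opp_continuous.

End CircleGroup.

(* f is open as a map onto its image, the latter with the subspace topology. *)
Definition open_onto_image (S T : topologicalType) (f : S -> T) : Prop :=
  forall U : set S, open U ->
    exists2 V : set T, open V & f @` U = V `&` range f.

Record twisted_sum (Y X Z : topologicalZmodType)
    (i : {additive Y -> X}) (p : {additive X -> Z}) : Prop := TwistedSum {
  twisted_sum_inj : injective i;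
  twisted_sum_exact : range i = [set x | p x = 0];
  twisted_sum_surj : range p = setT;
  twisted_sum_continuous_inj : continuous i;
  twisted_sum_continuous_proj : continuous p;
  twisted_sum_open_inj : open_onto_image i;
  twisted_sum_open_proj : open_onto_image p
}.

(* Y * Z carries the product topology and the componentwise group structure. *)
Definition splits (Y X Z : topologicalZmodType)
    (i : {additive Y -> X}) (p : {additive X -> Z}) : Prop :=
  exists Phi : {additive X -> Y * Z},
    [/\ continuous Phi,
        forall y, Phi (i y) = (y, 0) &
        forall x, (Phi x).2 = p x].

(* G belongs to the class S_TG(Y).  No separation is required of X. *)
Definition S_TG (Y G : topologicalZmodType) : Prop :=
  forall (X : topologicalZmodType)
    (i : {additive Y -> X}) (p : {additive X -> G}),
    twisted_sum i p -> splits i p.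

(* Precompactness with respect to the group structure (finitely many translates
   of any neighborhood of 0 suffice); the library's [precompact A] says instead
   that [closure A] is compact, which is stronger when G is not complete. *)
Definition group_precompact (G : topologicalZmodType) (U : set G) : Prop :=
  forall V : set G, nbhs (0 : G) V ->
    exists2 F : set G, finite_set F & U `<=` [set x + y | x in F & y in V].

Definition locally_group_precompact (G : topologicalZmodType) : Prop :=
  exists2 U : set G, nbhs (0 : G) U & group_precompact U.

(* Main.v *)
Require Import Defs.
From HB Require Import structures.
From mathcomp Require Import all_boot all_order all_algebra.
From mathcomp Require Import finmap.
From mathcomp Require Import all_classical reals.
From mathcomp Require Import topology normedtype.
From mathcomp Require Import complex.
From mathcomp Require Import zify ring lra.

Set Implicit Arguments.
Unset Strict Implicit.
Unset Printing Implicit Defensive.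

Import Order.TTheory GRing.Theory Num.Theory.
Import numFieldNormedType.Exports.

Local Open Scope classical_set_scope.
Local Open Scope ring_scope.

(** Write a twisted sum as 0 -> T -> X -> G -> 0.  It splits as soon as the
identity of T extends to a continuous character [chi] of X, for then
x |-> (chi x, p x) is a splitting.  Since T is divisible, the identity extends
to some homomorphism [chi0 : X -> T] ([hom_extension]), usually discontinuous,
and what has to be found is a character [psi] of the discrete group G such that
[chi0 - psi \o p] is continuous.  Let [tau v := chi0 (sec v)], where [sec]
picks preimages close to 0 of the points v close to 0.  Because T and G carry
the subspace and quotient topologies, [tau] is a homomorphism near 0 up to
small errors, and the problem becomes to find a character [psi] of G uniformly
close to [tau] on a neighborhood of 0: a homomorphism into T that stays in a
half plane near 0 is continuous ([character_continuous]).

Local precompactness provides, in place of Haar measure, the finite sets of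
[local_folner]: every neighborhood V of 0 contains, for every finite set S of
sufficiently small elements, a finite nonempty set almost invariant under the
translations by S.  The point is that the smallness of S depends on V and on
the desired accuracy only.

Given an almost invariant set Y, the Fourier transform of the function equal to
[tau] on Y and to 0 elsewhere weights the characters of G in such a way that, by
Parseval, for each small s the average of Re (psi(s) / tau(s)) is close to 1.
The Parseval identity holds because finitely many nonzero elements of an Abelian
group are annihilated on average by a suitable finite family of characters
([orthogonal_characters]).  Hence some [psi] is close to [tau] on average over any
prescribed finite set P of small elements ([character_near_on_average]).  If P is
itself half-invariant under a smaller finite set S, every s0 in S is a difference
of two good elements of P, and [psi] is close to [tau] at every point of S, with
a bound independent of S ([characters_near_local_hom]).  Compactness of the space
of all functions G -> T turns these finite statements into one character
([character_near_of_finite]). *)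

(** * The circle in real coordinates *)

Section CircleCoordinates.
Variable R : realType.
Implicit Types s t : circle R.

(** The defect [1 - cs t], half the squared distance from t to the neutral
element, serves below as the size of t: it is real valued, even, and subadditive
up to a factor 2. *)
Definition cs t : R := complex.Re (circle_val t).
Definition sn t : R := complex.Im (circle_val t).

Lemma cs0 : cs 0 = 1. Proof. by []. Qed.

Lemma csD s t : cs (s + t) = cs s * cs t - sn s * sn t.
Proof.
by rewrite /cs /sn circle_valD; case: (circle_val s) (circle_val t) => a b [].
Qed.

Lemma snD s t : sn (s + t) = cs s * sn t + sn s * cs t.
Proof.
rewrite /cs /sn circle_valD.
by case: (circle_val s) (circle_val t) => a b [c d] /=; rewrite addrC.
Qed.

Lemma cs2Dsn2 t : cs t ^+ 2 + sn t ^+ 2 = 1.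
Proof.
apply: (@complexI R).
by rewrite (add_Re2_Im2 (circle_val t : complex R)) (eqP (circle_norm1 t)) expr1n.
Qed.

Lemma csN t : cs (- t) = cs t.
Proof.
have := csD t (- t); have := snD t (- t); rewrite subrr cs0 => h1 h2.
have h3 := cs2Dsn2 t.
have -> : cs (- t) = cs t * (cs t * cs (- t) - sn t * sn (- t)) +
  sn t * (cs t * sn (- t) + sn t * cs (- t)).
  by rewrite -[LHS]mul1r -h3; ring.
by rewrite -h2 -h1 mulr1 /sn circle_val0 mulr0 addr0.
Qed.

Lemma snN t : sn (- t) = - sn t.
Proof.
have := csD t (- t); have := snD t (- t); rewrite subrr cs0 => h1 h2.
have h3 := cs2Dsn2 t.
have -> : sn (- t) = cs t * (cs t * sn (- t) + sn t * cs (- t)) -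
  sn t * (cs t * cs (- t) - sn t * sn (- t)).
  by rewrite -[LHS]mul1r -h3; ring.
by rewrite -h2 -h1 mulr1 /sn circle_val0 mulr0 add0r.
Qed.

Lemma cs_le1 t : cs t <= 1.
Proof. have := cs2Dsn2 t; nra. Qed.

(** Parallelogram law for the complex numbers s(t - 1) and s - 1, whose sum is
st - 1. *)
Lemma cs_subadd s t : 1 - cs (s + t) <= 2 * (1 - cs s) + 2 * (1 - cs t).
Proof.
rewrite csD.
have := cs2Dsn2 t; have := cs2Dsn2 s.
have := sqr_ge0 (sn s - sn t); have := sqr_ge0 (cs s + cs t - 2).
nra.
Qed.

Lemma circle_norm_sq t : `|circle_val t - 1 : complex R| ^+ 2 = (2 * (1 - cs t))%:C%C.
Proof.
have := cs2Dsn2 t; rewrite -(add_Re2_Im2 (circle_val t - 1 : complex R)) /cs /sn.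
case: (circle_val t) => a b /= h; congr (_ %:C)%C; rewrite subr0.
move: h; rewrite !expr2 => h; lra.
Qed.

Lemma ltr_norm_Re (z : complex R) (e : R) :
  `|z| < e%:C%C -> `|complex.Re z| < e.
Proof.
rewrite normc_def ltcR; apply: le_lt_trans.
by rewrite -sqrtr_sqr ler_wsqrtr // lerDl sqr_ge0.
Qed.

Lemma cs_continuous : continuous cs.
Proof.
move=> x; apply/(@cvgrPdist_lt _ _ _ _ (@nbhs_filter (circle R) x)) => e e0.
have /(@cvgrPdist_lt _ _ _ _ (@nbhs_filter (circle R) x)) /(_ e%:C%C) :=
  @circle_val_continuous R x.
rewrite ltcR => /(_ e0); apply: filterS => y /ltr_norm_Re.
by rewrite /cs; case: (circle_val x) (circle_val y) => a b [].
Qed.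

Lemma cs_nbhs0 (A : set (circle R)) : nbhs 0 A ->
  exists2 e : R, 0 < e & forall t, 1 - cs t < e -> A t.
Proof.
rewrite nbhsE => -[_ [[B oB <-] B0] BA].
have /nbhs_ballP [e e0 eB] : nbhs (circle_val 0 : (complex R)^o) B.
  exact: open_nbhs_nbhs.
have eE : e = (complex.Re e)%:C%C by rewrite RRe_real // gtr0_real.
have e0' : 0 < complex.Re e by rewrite -ltcR -eE.
exists (complex.Re e ^+ 2 / 2); first by rewrite divr_gt0 // exprn_gt0.
move=> t te; apply: BA; apply: eB; rewrite -ball_normE /=.
suff : `|1 - circle_val t : complex R| < e by [].
rewrite distrC -ltr_sqr ?nnegrE ?normr_ge0 ?ltW //.
rewrite circle_norm_sq eE -rmorphXn ltcR /=; lra.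
Qed.

End CircleCoordinates.

(** * Extension of homomorphisms into a divisible group *)

Section Extension.
Variables A D : zmodType.
Implicit Types Gamma Delta : set (A * D).

(** Graph of a homomorphism from a subgroup of A to D. *)
Definition partial_hom Gamma :=
  [/\ Gamma 0, (forall u v, Gamma u -> Gamma v -> Gamma (u - v)) &
      forall d, Gamma (0, d) -> d = 0].

Lemma partial_homN Gamma u : partial_hom Gamma -> Gamma u -> Gamma (- u).
Proof. by case=> G0 GB _ Gu; rewrite -sub0r; exact: GB. Qed.

Lemma partial_homD Gamma u v :
  partial_hom Gamma -> Gamma u -> Gamma v -> Gamma (u + v).
Proof.
by move=> hG Gu Gv; rewrite -[v]opprK; case: (hG) => _ GB _; apply: GB => //;
  exact: partial_homN.
Qed.

Lemma partial_homMn Gamma u n : partial_hom Gamma -> Gamma u -> Gamma (u *+ n).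
Proof.
move=> hG Gu; elim: n => [|n IH]; first by rewrite mulr0n; case: hG.
by rewrite mulrS; exact: partial_homD.
Qed.

Lemma pair_mulrn (a : A) (d : D) n : (a, d) *+ n = (a *+ n, d *+ n).
Proof. by elim: n => [|n IH]; rewrite ?mulr0n ?mulrS ?IH. Qed.

Lemma partial_hom_uniq Gamma a d e :
  partial_hom Gamma -> Gamma (a, d) -> Gamma (a, e) -> d = e.
Proof.
case=> _ GB G0 Gd Ge; apply/subr0_eq/G0.
by rewrite -(subrr a); exact: (GB _ _ Gd Ge).
Qed.

(** The extension step in Zorn's argument.  Applied to the zero graph, it also
defines homomorphisms on cyclic subgroups. *)
Lemma partial_hom_adjoin Delta a d : partial_hom Delta ->
  (forall n e, Delta (a *+ n, e) -> e = d *+ n) ->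
  partial_hom [set u | exists (k : int) x y,
    Delta (x, y) /\ u = (x + a *~ k, y + d *~ k)].
Proof.
move=> hD ad; case: (hD) => D0 DB Df.
have adz (k : int) e : Delta (a *~ k, e) -> e = d *~ k.
  case: k => n; first exact: ad.
  move=> ke; have : Delta (a *+ n.+1, - e).
    have := partial_homN hD ke; congr (Delta _).
    by rewrite NegzE mulrNz; congr (_, _); rewrite /= opprK.
  by move/ad=> de; rewrite NegzE mulrNz -pmulrn -de opprK.
split.
- by exists 0, 0, 0; split=> //; rewrite !mulr0z !addr0.
- move=> _ _ [k [x [y [xy ->]]]] [l [x' [y' [xy' ->]]]].
  exists (k - l), (x - x'), (y - y'); split; first exact: (DB _ _ xy xy').
  by rewrite !mulrzBr; congr (_, _); rewrite /= opprD addrACA.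
- move=> e [k [x [y [xy [x0 ->]]]]].
  have /adz <- : Delta (a *~ k, - y).
    have -> : a *~ k = - x by apply/eqP; rewrite -addr_eq0 addrC -x0.
    exact: (partial_homN hD xy).
  by rewrite subrr.
Qed.

Hypothesis D_divisible : forall n (d : D), (0 < n)%N -> exists e, e *+ n = d.

(** If some positive multiple of a lies in the domain, let m be the least one;
all the others are multiples of m a, so that it suffices to divide the value at
m a by m. *)
Lemma partial_hom_next Delta a : partial_hom Delta ->
  exists d, forall n e, Delta (a *+ n, e) -> e = d *+ n.
Proof.
move=> hD; have [[n n0 [t nt]]|no] :=
  pselect (exists2 n, (0 < n)%N & exists t, Delta (a *+ n, t)); last first.
  exists 0 => -[|n] e ne; first by rewrite mulr0n in ne *; case: hD => _ _; exact.
  by case: no; exists n.+1 => //; exists e.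
have ex : exists n, (0 < n)%N && `[< exists t, Delta (a *+ n, t) >].
  by exists n; rewrite n0; apply/asboolP; exists t.
case: (ex_minnP ex) => {n0 nt ex}{t} m /andP[m0 /asboolP[t mt]] min_m.
have [d dt] := D_divisible t m0; exists d => k e ke.
have ke' : Delta (a *+ (k %% m), e - t *+ (k %/ m)).
  have := partial_homMn (k %/ m) hD mt.
  case: (hD) => _ DB _ /(DB _ _ ke); congr (Delta _).
  rewrite pair_mulrn; congr (_, _) => /=.
  by rewrite -mulrnA {1}(divn_eq k m) mulrnDr [(m * _)%N]mulnC addrAC subrr add0r.
have km : (k %% m = 0)%N.
  apply/eqP; rewrite -leqn0 leqNgt; apply/negP => km0.
  have := min_m (k %% m)%N; rewrite km0 leqNgt ltn_pmod //= => /(_ _)/negP.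
  by apply=> //; apply/asboolP; exists (e - t *+ (k %/ m)).
move: ke'; rewrite km mulr0n; case: (hD) => _ _ Df /Df /subr0_eq ->.
by rewrite -dt -mulrnA {2}(divn_eq k m) km addn0 mulnC.
Qed.

(** Zorn's lemma.  The order is on sets B such that [Gamma `|` B] is a graph,
rather than on graphs containing Gamma, so that the empty chain needs no separate
treatment. *)
Theorem hom_extension Gamma : partial_hom Gamma ->
  exists f : A -> D, GRing.zmod_morphism f /\ forall a d, Gamma (a, d) -> f a = d.
Proof.
move=> hG; case: (hG) => G0 GB Gf.
have [F FP Ftot|B [PB maxB]] := @Zorn_bigcup _ [set B | partial_hom (Gamma `|` B)].
  have common u v : (Gamma `|` \bigcup_(X in F) X) u ->
      (Gamma `|` \bigcup_(X in F) X) v ->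
      exists Delta, [/\ partial_hom Delta, Delta `<=` Gamma `|` \bigcup_(X in F) X,
        Delta u & Delta v].
    have sub X : F X -> Gamma `|` X `<=` Gamma `|` \bigcup_(X in F) X.
      by move=> FX x [|Xx]; [left|right; exists X].
    move=> [Gu|[X FX Xu]] [Gv|[Y FY Yv]].
    - by exists Gamma; split=> // x; left.
    - by exists (Gamma `|` Y); split; [exact: FP|exact: sub|left|right].
    - by exists (Gamma `|` X); split; [exact: FP|exact: sub|right|left].
    - have [XY|YX] := Ftot _ _ FX FY.
      + by exists (Gamma `|` Y); split; [exact: FP|exact: sub|right; exact: XY|right].
      + by exists (Gamma `|` X); split; [exact: FP|exact: sub|right|right; exact: YX].
  split; first by left.
  - by move=> u v /common h /h [Delta [[_ DB _] sD Du Dv]]; apply/sD/DB.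
  - by move=> d h; have [Delta [[_ _ Df] _ Dd _]] := common _ _ h h; exact: Df.
have total a : exists d, (Gamma `|` B) (a, d).
  apply: contrapT => nad; have [d ad] := partial_hom_next a PB.
  have := partial_hom_adjoin PB ad; set Delta := [set _ | _] => hD.
  have sD : Gamma `|` B `<=` Delta.
    by move=> [x y] xy; exists 0, x, y; split=> //; rewrite !mulr0z !addr0.
  apply: (maxB Delta); last first.
    by rewrite /= setUC setUidl // => x Gx; apply: sD; left.
  split; first by move=> x Bx; apply: sD; right.
  move=> DsB; apply: nad; exists d; right; apply: DsB.
  by exists 1, 0, 0; split; [case: PB|rewrite !mulr1z !add0r].
have [f fP] := choice total; exists f; split=> [x y|a d ad].
  case: (PB) => _ PBB _.
  exact: (partial_hom_uniq PB (fP _) (PBB _ _ (fP x) (fP y))).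
by apply: (partial_hom_uniq PB (fP _)); left.
Qed.

End Extension.

(** * Finite families of characters satisfying orthogonality relations *)

Section CircleRoots.
Variable R : realType.
Implicit Types s t : circle R.

Lemma circle_valMn t n : circle_val (t *+ n) = circle_val t ^+ n :> complex R.
Proof.
by elim: n => [|n IH]; rewrite ?mulr0n ?mulrS ?circle_valD ?IH ?exprS.
Qed.

Lemma circle_of_root n (z : complex R) : (0 < n)%N -> `|z ^+ n| = 1 ->
  {t : circle R | circle_val t = z}.
Proof.
move=> n0; rewrite normrX => /eqP; rewrite pexpr_eq1 // => z1.
by exists (Circle (z1 : `|z : (complex R)^o| == 1)).
Qed.

Lemma circle_divisible n t : (0 < n)%N -> exists s, s *+ n = t.
Proof.
move=> n0; have nK : (n.-root (circle_val t : complex R)) ^+ n = circle_val t.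
  by rewrite rootCK.
have [s sE] : {s : circle R | circle_val s = n.-root (circle_val t : complex R)}.
  by apply: (circle_of_root n0); rewrite nK; exact/eqP/circle_norm1.
by exists s; apply: val_inj; rewrite /= circle_valMn sE nK.
Qed.

Lemma cs_sumE (I : Type) (r : seq I) (f : I -> circle R) :
  \sum_(i <- r) circle_val (f i) =
   Complex (\sum_(i <- r) cs (f i)) (\sum_(i <- r) sn (f i)) :> complex R.
Proof.
elim: r => [|i r IH]; first by rewrite !big_nil.
by rewrite !big_cons IH /cs /sn; case: (circle_val (f i)).
Qed.

(** A root of 1 + X + ... + X^(n-1) is an n-th root of unity, hence of modulus 1. *)
Lemma circle_sum_root n : (1 < n)%N -> exists t,
  [/\ t *+ n = 0, \sum_(j < n) cs (t *+ j) = 0 & \sum_(j < n) sn (t *+ j) = 0].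
Proof.
case: n => [//|[//|n _]].
have [z zE] : exists z : complex R, z ^+ n.+1 = \sum_(i < n.+1) -1 * z ^+ i.
  exact: (@GRing.solve_monicpoly (complex R) n.+1 (fun=> -1)).
have z0 : \sum_(j < n.+2) z ^+ j = 0.
  rewrite big_ord_recr /= zE -big_split big1 //= => i _.
  by rewrite mulN1r subrr.
have z1 : z ^+ n.+2 = 1.
  by apply/eqP; rewrite -subr_eq0 subrX1 z0 mulr0.
have nz1 : `|z ^+ n.+2| = 1 by rewrite z1 normr1.
have [t tE] := circle_of_root (ltn0Sn n.+1) nz1.
have : \sum_(j < n.+2) circle_val (t *+ j) = 0 :> complex R.
  by rewrite -[RHS]z0; apply: eq_bigr => j _; rewrite circle_valMn tE.
rewrite cs_sumE => -[c0 s0]; exists t; split=> //.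
by apply: val_inj; rewrite /= circle_valMn tE; exact: z1.
Qed.

End CircleRoots.

Section Orthogonality.
Variables (R : realType) (A : zmodType).
Implicit Types psi : A -> circle R.

Lemma zmod_morphism0 psi : GRing.zmod_morphism psi -> psi 0 = 0.
Proof. by move=> h; rewrite -(subrr 0) h subrr. Qed.

Lemma zmod_morphismN psi x : GRing.zmod_morphism psi -> psi (- x) = - psi x.
Proof. by move=> h; rewrite -sub0r h (zmod_morphism0 h) sub0r. Qed.

Lemma zmod_morphismD psi x y : GRing.zmod_morphism psi -> psi (x + y) = psi x + psi y.
Proof. by move=> h; rewrite -{1}[y]opprK h (zmod_morphismN _ h) opprK. Qed.

(** Take n to be the order of s if it is finite and 2 otherwise: in both cases
every relation k s = 0 forces n to divide k, so that s may be sent to any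
element of the circle killed by n. *)
Lemma character_with_null_sum (s : A) : s != 0 ->
  exists psi n, [/\ GRing.zmod_morphism psi, (0 < n)%N,
    \sum_(j < n) cs (psi s *+ j) = 0 & \sum_(j < n) sn (psi s *+ j) = 0].
Proof.
move=> s0.
have [n n1 sn0] : exists2 n, (1 < n)%N & forall k, s *+ k = 0 -> (n %| k)%N.
  have [[k k0 sk]|no] := pselect (exists2 k, (0 < k)%N & s *+ k = 0); last first.
    exists 2%N => // -[//|k sk]; by case: no; exists k.+1.
  have ex : exists k, (0 < k)%N && (s *+ k == 0) by exists k; rewrite k0 sk eqxx.
  case: (ex_minnP ex) => n /andP[n0 /eqP sn0] min_n; exists n.
    by case: n n0 sn0 {min_n} => [//|[|//]] _ /eqP; rewrite mulr1n (negPf s0).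
  move=> l sl; rewrite /dvdn -leqn0 leqNgt; apply/negP => l0.
  have := min_n (l %% n)%N; rewrite l0 leqNgt ltn_pmod //= => /(_ _)/negP.
  apply=> //; move: sl; rewrite {1}(divn_eq l n) mulrnDr mulnC mulrnA sn0.
  by rewrite mul0rn add0r => ->.
have [t [tn c0 s0']] := circle_sum_root R n1.
have triv : @partial_hom A (circle R) [set 0].
  split=> [//|u v -> ->|d [->//]]; exact: subr0.
have compat k e : [set 0] (s *+ k, e) -> e = t *+ k.
  by case=> /sn0 /dvdnP[q ->] ->; rewrite mulnC mulrnA tn mul0rn.
have [psi [hpsi psiE]] :=
  hom_extension (@circle_divisible R) (partial_hom_adjoin triv compat).
have psis : psi s = t.
  by apply: psiE; exists 1, 0, 0; split; rewrite ?mulr1z ?add0r.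
by exists psi, n; split; rewrite ?psis // ltnW.
Qed.

(** Adding two families of characters multiplies the complex sums of their values
at each point, so the relations obtained for the elements of S one at a time
combine. *)
Lemma orthogonal_characters (S : seq A) : 0 \notin S ->
  exists (I : finType) (psi : I -> A -> circle R),
  [/\ (0 < #|I|)%N, forall i, GRing.zmod_morphism (psi i) &
    forall s, s \in S -> \sum_i cs (psi i s) = 0 /\ \sum_i sn (psi i s) = 0].
Proof.
elim: S => [_|a S IH]; first by exists 'I_1, (fun _ _ => 0);
  split=> [|i x y|//]; rewrite ?card_ord ?subr0.
rewrite inE negb_or eq_sym => /andP[a0 /IH [I [psi [I0 hpsi sumS]]]].
have [phi [n [hphi n0 c0 s0]]] := character_with_null_sum a0.
exists (I * 'I_n)%type, (fun (ij : I * 'I_n) x => psi ij.1 x + phi x *+ ij.2); split.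
- by rewrite card_prod card_ord muln_gt0 I0.
- by move=> [i j] x y /=; rewrite hpsi hphi mulrnBl opprD addrACA.
- move=> s; rewrite inE => sS.
  pose ci : R := \sum_i cs (psi i s); pose si : R := \sum_i sn (psi i s).
  pose cj : R := \sum_(j < n) cs (phi s *+ j).
  pose sj : R := \sum_(j < n) sn (phi s *+ j).
  have [hc hs] : ci * cj - si * sj = 0 /\ ci * sj + si * cj = 0.
    case/predU1P: sS => [sa|/sumS[]]; last by rewrite -/ci -/si => -> ->; split; ring.
    by rewrite /cj /sj sa c0 s0; split; ring.
  split.
    transitivity (ci * cj - si * sj); last exact: hc.
    rewrite /ci /cj /si /sj !big_distrlr /= -sumrB.
    rewrite -(pair_bigA _ (fun i (j : 'I_n) => cs (psi i s + phi s *+ j))).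
    by apply: eq_bigr => i _; rewrite -sumrB; apply: eq_bigr => j _; rewrite csD.
  transitivity (ci * sj + si * cj); last exact: hs.
  rewrite /ci /cj /si /sj !big_distrlr /= -big_split.
  rewrite -(pair_bigA _ (fun i (j : 'I_n) => sn (psi i s + phi s *+ j))).
  by apply: eq_bigr => i _; rewrite -big_split; apply: eq_bigr => j _; rewrite snD.
Qed.

End Orthogonality.

(** * A character close to a given function on average *)

Section FiniteFourier.
Variables (R : realType) (A : zmodType).
Implicit Types (tau psi : A -> circle R) (Y P : {fset A}).

Lemma weighted_pigeonhole (I : finType) (w g : I -> R) (b : R) :
  (forall i, 0 <= w i) -> 0 < \sum_i w i ->
  \sum_i w i * g i <= b * \sum_i w i -> exists i, g i <= b.
Proof.
move=> w0 sw; apply: contraPP => /forallNP gb; apply/negP; rewrite -ltNge.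
have {}gb i : b < g i by rewrite ltNge; apply/negP/gb.
rewrite -subr_gt0 mulr_sumr -sumrB.
have [i wi] : exists i, 0 < w i.
  apply: contrapT => /forallNP h; move: sw; rewrite big1 ?ltxx // => i _.
  by apply/eqP; rewrite eq_le w0 andbT leNgt; apply/negP/h.
have ge0 j : 0 <= w j * g j - b * w j.
  by rewrite [b * _]mulrC -mulrBr mulr_ge0 // subr_ge0 ltW.
rewrite (bigD1 i) //= ltr_pwDl ?sumr_ge0 //.
by rewrite [b * _]mulrC -mulrBr mulr_gt0 // subr_gt0.
Qed.

Lemma sqr_sum_mul_cs (Y : seq A) (f : A -> circle R) t :
  ((\sum_(y <- Y) cs (f y)) ^+ 2 + (\sum_(y <- Y) sn (f y)) ^+ 2) * cs t =
  \sum_(x <- Y) \sum_(y <- Y) cs (f x - f y + t).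
Proof.
set c := \sum_(y <- Y) cs (f y); set d := \sum_(y <- Y) sn (f y).
transitivity ((c * c + d * d) * cs t - (d * c - c * d) * sn t); first by ring.
rewrite /c /d !big_distrlr /= -big_split -sumrB !mulr_suml -sumrB.
apply: eq_bigr => x _; rewrite /= -big_split -sumrB !mulr_suml -sumrB.
by apply: eq_bigr => y _; rewrite !csD !snD !csN !snN /=; ring.
Qed.

Lemma sum_cs_translate (I : finType) (f : I -> circle R) u :
  \sum_i cs (u + f i) = cs u * \sum_i cs (f i) - sn u * \sum_i sn (f i).
Proof.
by rewrite !mulr_sumr -sumrB; apply: eq_bigr => i _; rewrite csD.
Qed.

(** The weight of psi i is the squared modulus of the Fourier coefficient at psi i
of the function equal to tau on Y and to 0 elsewhere; expanding the square and
using orthogonality leaves only the pairs of points of Y that differ by s. *)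
Lemma autocorrelation (I : finType) (psi : I -> A -> circle R) (tau : A -> circle R)
    (Y : {fset A}) (s : A) (t : circle R) :
  (forall i, GRing.zmod_morphism (psi i)) ->
  (forall x y, x \in Y -> y \in Y -> x != y + s ->
    \sum_i cs (psi i (y + s - x)) = 0 /\ \sum_i sn (psi i (y + s - x)) = 0) ->
  \sum_i ((\sum_(y <- Y) cs (tau y - psi i y)) ^+ 2 +
          (\sum_(y <- Y) sn (tau y - psi i y)) ^+ 2) * cs (psi i s + t) =
  #|I|%:R * \sum_(y <- Y | y + s \in Y) cs (tau (y + s) - tau y + t).
Proof.
move=> hpsi orth.
transitivity (\sum_(y <- Y) \sum_(x <- Y) \sum_i
    cs ((tau x - tau y + t) + psi i (y + s - x))).
  under eq_bigr do rewrite sqr_sum_mul_cs.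
  rewrite exchange_big [RHS]exchange_big /=; apply: eq_bigr => x _.
  rewrite exchange_big /=; apply: eq_bigr => y _; apply: eq_bigr => i _.
  congr cs; rewrite (hpsi i (y + s)) (zmod_morphismD _ _ (hpsi i)) opprB.
  by rewrite (AC (2*2*2) (1*4*6*(3*5*2))).
rewrite mulr_sumr [RHS]big_mkcond big_seq [RHS]big_seq; apply: eq_bigr => y yY.
have off x : x \in Y -> x != y + s ->
    \sum_i cs (tau x - tau y + t + psi i (y + s - x)) = 0.
  move=> xY xy; rewrite sum_cs_translate.
  by have [-> ->] := orth x y xY yY xy; rewrite !mulr0 subrr.
case: ifPn => ysY; last first.
  rewrite big_seq big1 // => x xY; apply: off => //.
  by apply: contraNneq ysY => <-.
rewrite (big_fsetD1 (y + s)) //= [X in _ + X]big_seq [X in _ + X]big1 ?addr0.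
  rewrite (eq_bigr (fun=> cs (tau (y + s) - tau y + t))); last first.
    by move=> i _; rewrite subrr zmod_morphism0 // addr0.
  by rewrite sumr_const mulr_natl.
by move=> x; rewrite !inE => /andP[xy xY]; apply: off.
Qed.

(** By [autocorrelation] with t = - tau s, the hypothesis bounds from below, for
each s in P, the average of cs (psi s - tau s) over the characters of a suitable
orthogonal family, weighted by the squared Fourier coefficients of tau on Y.
Averaging over P as well and exchanging the two averages singles out one
character. *)
Lemma character_near_on_average tau Y P (e : R) : Y != fset0 ->
  (forall s, s \in P -> (1 - e) * #|` Y|%:R <=
     \sum_(y <- Y | y + s \in Y) cs (tau (y + s) - tau y - tau s)) ->
  exists psi, GRing.zmod_morphism psi /\
    \sum_(s <- P) (1 - cs (psi s - tau s)) <= e * #|` P|%:R.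
Proof.
move=> Y0 hY.
pose D := [seq y - x | y <- enum_fset Y, x <- enum_fset Y].
pose S := [seq z <- [seq d + s | d <- D, s <- 0 :: enum_fset P] | z != 0].
have S0 : 0 \notin S by rewrite mem_filter /= eqxx.
have [I [psi [I0 hpsi orth]]] := orthogonal_characters R S0.
have orthY x y s : s \in 0 :: enum_fset P -> x \in Y -> y \in Y -> x != y + s ->
    \sum_i cs (psi i (y + s - x)) = 0 /\ \sum_i sn (psi i (y + s - x)) = 0.
  move=> sP xY yY xy; apply: orth; rewrite mem_filter.
  apply/andP; split; first by rewrite subr_eq0 eq_sym.
  by rewrite addrAC; apply: allpairs_f => //; exact: allpairs_f.
pose w i : R := (\sum_(y <- Y) cs (tau y - psi i y)) ^+ 2 +
          (\sum_(y <- Y) sn (tau y - psi i y)) ^+ 2.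
have auto s t : s \in 0 :: enum_fset P -> \sum_i w i * cs (psi i s + t) =
    #|I|%:R * \sum_(y <- Y | y + s \in Y) cs (tau (y + s) - tau y + t).
  by move=> sP; apply: autocorrelation => // x y; apply: orthY.
have sw : \sum_i w i = #|I|%:R * #|` Y|%:R.
  transitivity (\sum_i w i * cs (psi i 0 + 0)).
    by apply: eq_bigr => i _; rewrite zmod_morphism0 // addr0 mulr1.
  rewrite auto ?mem_head //; congr (_ * _).
  rewrite big_seq_cond (eq_bigr (fun=> 1)); last by move=> y; rewrite addr0 subrr addr0.
  rewrite (eq_bigl (fun y => y \in Y)); last by move=> y; rewrite addr0 andbb.
  by rewrite -big_seq big_const_seq count_predT iter_addr_0 .
have [i|||i hi] /= := @weighted_pigeonhole I w
   (fun i => \sum_(s <- P) (1 - cs (psi i s - tau s))) (e * #|` P|%:R).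
- by rewrite addr_ge0 ?sqr_ge0.
- by rewrite sw mulr_gt0 ?ltr0n // cardfs_gt0.
- under eq_bigr do rewrite mulr_sumr.
  rewrite exchange_big /= big_seq.
  apply: (@le_trans _ _ (\sum_(s <- P | s \in P) e * \sum_i w i)).
    apply: ler_sum => s sP; under eq_bigr do rewrite mulrBr mulr1.
    rewrite sumrB auto; last by rewrite inE sP orbT.
    have := ler_wpM2l (ler0n R #|I|) (hY s sP); rewrite sw.
    rewrite mulrBl mulrBr mul1r lerBlDr -lerBlDl => /le_trans; apply.
    by rewrite mulrCA lexx.
  rewrite -big_seq big_const_seq count_predT iter_addr_0.
  by rewrite -[leLHS]mulr_natr mulrAC.
by exists (psi i).
Qed.

End FiniteFourier.

(** * Counting pairs of neighboring points *)

Section PairCounting.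
Variable A : zmodType.
Implicit Types (V Q : set A) (B : seq A).

Definition near_count V B (z : A) : nat := (\sum_(y <- B) `[< V (y - z)%R >])%N.
Definition pair_count V B : nat := (\sum_(z <- B) near_count V B z)%N.

Lemma exists_max_in (f : A -> nat) B x : x \in B ->
  exists2 c, c \in B & forall y, y \in B -> (f y <= f c)%N.
Proof.
elim: B x => [//|b B IH] x _; case: B IH => [|b' B] IH.
  by exists b; rewrite ?mem_head // => y; rewrite inE => /eqP->.
have [c cB maxc] := IH b' (mem_head _ _).
have [bc|cb] := leqP (f b) (f c).
  by exists c => [|y]; rewrite inE ?cB ?orbT // => /predU1P[->//|/maxc].
exists b => [|y]; rewrite ?mem_head // inE => /predU1P[->//|/maxc yc].
exact: leq_trans yc (ltnW cb).
Qed.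

Lemma sum_filterC (p : pred A) B (f : A -> nat) :
  (\sum_(y <- B) f y =
   \sum_(y <- [seq y <- B | p y]) f y + \sum_(y <- [seq y <- B | ~~ p y]) f y)%N.
Proof. by rewrite !big_filter (bigID p). Qed.

(** Each of the translates of Q that cover V, moved to x, either misses B or meets
it inside the V2-neighborhood of a point of B. *)
Lemma near_count_cover Q V2 V (F : seq A) B d x :
  (forall a b, Q a -> Q b -> V2 (a - b)) ->
  (forall v, V v -> exists2 f, f \in F & Q (v - f)) ->
  (forall y, y \in B -> (near_count V2 B y <= d)%N) ->
  (near_count V B x <= size F * d)%N.
Proof.
move=> QV2 cover maxd.
apply: (@leq_trans (\sum_(f <- F) near_count Q B (x + f))%N); last first.
  rewrite -sum1_size big_distrl /=; apply: leq_sum => f _; rewrite mul1n.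
  have [[b bB Qb]|no] := pselect (exists2 b, b \in B & Q (b - (x + f))).
    apply: leq_trans (maxd b bB); apply: leq_sum => y _.
    case: asboolP => // Qy; case: asboolP => // -[].
    by have := QV2 _ _ Qy Qb; rewrite opprB addrA subrK.
  rewrite /near_count big_seq big1 // => y yB; case: asboolP => // Qy.
  by case: no; exists y.
rewrite /near_count exchange_big /=; apply: leq_sum => y _.
case: asboolP => // /cover [f fF Qf]; rewrite (big_rem f) //=.
by rewrite -addrA -opprD in Qf; move/asboolP: Qf => ->.
Qed.

(** A counting substitute for the comparison of the Haar measures of V and V1,
with a constant that does not depend on B.  Remove from B the largest
V2-neighborhood C of one of its points: with d the cardinality of C, this
destroys at most 2 m d^2 of the pairs counted by V, where m is the number of
translates of Q, and at least d^2 of the pairs counted by V1. *)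
Lemma pair_count_cover Q V2 V1 V (F B : seq A) :
  (forall a b, Q a -> Q b -> V2 (a - b)) ->
  (forall a b, V2 a -> V2 b -> V1 (a - b)) -> V2 0 ->
  (forall a, V a -> V (- a)) ->
  (forall v, V v -> exists2 f, f \in F & Q (v - f)) ->
  (pair_count V B <= 2 * size F * pair_count V1 B)%N.
Proof.
move=> QV2 V21 V20 Vsym cover; have [n] := ubnP (size B).
elim: n B => [//|n IH] [|b0 B0] sB; first by rewrite /pair_count !big_nil muln0.
set B := b0 :: B0 in sB *.
have [c cB maxc] := exists_max_in (near_count V2 B) (mem_head b0 B0).
set d := near_count V2 B c in maxc.
pose p y := `[< V2 (y - c) >].
pose C := [seq y <- B | p y]; pose B' := [seq y <- B | ~~ p y].
have sC : size C = d.
  by rewrite size_filter -sum1_count big_mkcond; apply: eq_bigr => y _;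
    rewrite -/(p y); case: (p y).
have pc : p c by apply/asboolP; rewrite subrr.
have sB' : (size B' < n)%N.
  apply: leq_trans (_ : size B <= n)%N; last by [].
  by rewrite !size_filter -(count_predC p B) -[X in (X < _)%N]add0n ltn_add2r -has_count;
    apply/hasP; exists c.
have bound x : (near_count V B x <= size F * d)%N by exact: (near_count_cover x QV2 cover maxc).
have up : (pair_count V B <= 2 * (d * (size F * d)) + pair_count V B')%N.
  have sumC : (\sum_(z <- C) near_count V B z <= d * (size F * d))%N.
    rewrite -{1}sC -sum1_size big_distrl /=; apply: leq_sum => z _.
    by rewrite mul1n.
  rewrite mul2n -addnn /pair_count (sum_filterC p) -/C -/B' -addnA.
  apply: leq_add => //.
  rewrite /near_count; under eq_bigr do rewrite (sum_filterC p) -/C -/B'.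
  rewrite big_split /= leq_add2r; apply: leq_trans sumC.
  rewrite exchange_big /=; apply: leq_sum => y _.
  rewrite /near_count (sum_filterC p B) -/C -/B'.
  apply: leq_trans (leq_addl _ _); apply: leq_sum => z _.
  case: asboolP => // Vyz; case: asboolP => // -[].
  by have := Vsym _ Vyz; rewrite opprB.
have low : (d * d + pair_count V1 B' <= pair_count V1 B)%N.
  rewrite /pair_count (sum_filterC p _ (near_count V1 B)) -/C -/B'.
  apply: leq_add; last first.
    apply: leq_sum => z _; rewrite /near_count (sum_filterC p B) -/C -/B'.
    exact: leq_addl.
  rewrite -{1}sC -sum1_size big_distrl /= big_seq [leqRHS]big_seq.
  apply: leq_sum => z; rewrite mem_filter => /andP[/asboolP pz _]; rewrite mul1n.
  rewrite /near_count (sum_filterC p B) -/C -/B'.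
  apply: leq_trans (leq_addr _ _); rewrite -{1}sC -sum1_size big_seq [leqRHS]big_seq.
  apply: leq_sum => y; rewrite mem_filter => /andP[/asboolP py _].
  case: asboolP => // -[]; have := V21 _ _ py pz.
  by rewrite opprB addrA subrK.
have := IH B' sB'; nia.
Qed.

(** Combinations of the elements of l with coefficients between 0 and N.  As
sequences their sizes are exactly polynomial in N, which gives the subexponential
growth needed in [exists_box_center]. *)
Fixpoint box N (l : seq A) : seq A :=
  if l is s :: l' then [seq s *+ j + b | j <- iota 0 N.+1, b <- box N l'] else [:: 0].

Lemma size_box N l : size (box N l) = (N.+1 ^ size l)%N.
Proof. by elim: l => [//|s l IH]; rewrite [LHS]size_allpairs size_iota IH expnS. Qed.

Lemma mem_box_cons N s l x : reflect
  (exists j b, [/\ (j <= N)%N, b \in box N l & x = s *+ j + b]) (x \in box N (s :: l)).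
Proof.
apply: (iffP idP) => [/allpairsP[[j b] /= []]|[j [b [jN bB ->]]]].
  move=> jN bB ->; exists j, b; split=> //.
  by move: jN; rewrite -[_ :: _]/(iota 0 N.+1) mem_iota add0n ltnS.
by apply: allpairs_f => //; rewrite mem_iota.
Qed.

Lemma box0 N l : 0 \in box N l.
Proof.
elim: l => [|s l IH]; first exact: mem_head.
by apply/mem_box_cons; exists 0%N, 0; rewrite mulr0n addr0.
Qed.

Lemma box_mono M N l : (M <= N)%N -> {subset box M l <= box N l}.
Proof.
move=> MN; elim: l => [//|s l IH] x /mem_box_cons[j [b [jM bB ->]]].
by apply/mem_box_cons; exists j, b; split; rewrite ?IH // (leq_trans jM).
Qed.

Lemma box_translate N l x s : x \in box N l -> s \in l -> x + s \in box N.+1 l.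
Proof.
elim: l x => [//|r l IH] x /mem_box_cons[j [b [jN bB ->]]].
rewrite inE => /predU1P[->|sl]; apply/mem_box_cons.
  by exists j.+1, b; split=> //; [exact: box_mono bB|rewrite mulrSr addrAC].
by exists j, (b + s); split; [exact: leqW|exact: IH|rewrite addrA].
Qed.

End PairCounting.

Lemma polynomial_lt_exp2 n d : exists k, ((k * n).+1 ^ d < 2 ^ k)%N.
Proof.
pose u := (2 * d + n * d)%N; exists (2 ^ (2 * u))%N.
apply: (@leq_ltn_trans ((2 ^ (2 * u + n)) ^ d)%N).
  case: (posnP d) => [->//|d0]; rewrite leq_exp2r // expnD.
  have : (n < 2 ^ n)%N by exact: ltn_expl.
  have : (0 < 2 ^ (2 * u))%N by rewrite expn_gt0.
  nia.
rewrite -expnM ltn_exp2l //.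
have : (u < 2 ^ u)%N by exact: ltn_expl.
rewrite mul2n -addnn expnD /u; nia.
Qed.

(** Otherwise w would double every n steps. *)
Lemma slow_step (w : nat -> nat) n d : (0 < w 0)%N ->
  (forall N, (w N <= N.+1 ^ d)%N) -> exists N, (w (N + n) <= 2 * w N)%N.
Proof.
move=> w0 wd; apply: contrapT => /forallNP fast.
have expo k : (2 ^ k <= w (k * n))%N.
  elim: k => [//|k IH]; have /negP := fast (k * n)%N; rewrite -ltnNge.
  rewrite (mulSn k) [(n + _)%N]addnC expnS => step.
  by apply: leq_trans (ltnW step); rewrite leq_pmul2l.
have [k] := polynomial_lt_exp2 n d; rewrite ltnNge => /negP; apply.
exact: leq_trans (expo k) (wd _).
Qed.

(** * Almost invariant finite sets in locally precompact groups *)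

Section NeighborhoodsOfZero.
Variable A : topologicalZmodType.
Implicit Types V W : set A.

Lemma nbhs0_0 V : nbhs 0 V -> V 0.
Proof. exact: nbhs_singleton. Qed.

Lemma nbhs0N V : nbhs 0 V -> nbhs 0 [set x | V (- x)].
Proof. by move=> V0; apply: (@opp_continuous A 0); rewrite oppr0. Qed.

Lemma nbhs0_symmetric_half V : nbhs 0 V -> exists W : set A,
  [/\ nbhs 0 W, forall a, W a -> W (- a) & forall a b, W a -> W b -> V (a + b)].
Proof.
move=> V0.
have [[U1 U2] /= [U10 U20] sU] : nbhs ((0, 0) : A * A) [set x | V (x.1 + x.2)].
  by apply: (@add_continuous A (0, 0)); rewrite /= addr0.
exists (U1 `&` U2 `&` [set x | (U1 `&` U2) (- x)]); split.
- by apply: filterI; [|apply: nbhs0N]; exact: filterI.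
- by move=> a [Wa Wna]; split=> //=; rewrite opprK.
- by move=> a b [[U1a _] _] [[_ U2b] _]; apply: (sU (a, b)).
Qed.

Fixpoint iterated_sum V n : set A :=
  if n is n'.+1 then [set x + y | x in iterated_sum V n' & y in V] else [set 0].

Lemma iterated_sumS V W n : V `<=` W -> iterated_sum V n `<=` iterated_sum W n.
Proof.
move=> VW; elim: n => [//|n IH] _ [x Vx [y Vy <-]].
by exists x; [exact: IH|exists y => //; exact: VW].
Qed.

Lemma nbhs0_iterated n V : nbhs 0 V -> exists W : set A, nbhs 0 W /\
  forall j, (j <= n)%N -> iterated_sum W j `<=` V.
Proof.
elim: n V => [|n IH] V V0.
  by exists setT; split=> [|[|//] _ _ ->]; [exact: filterT|exact: nbhs0_0].
have [U [U0 _ UV]] := nbhs0_symmetric_half V0.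
have [W [W0 WU]] := IH U U0.
exists (W `&` U); split; first exact: filterI.
case=> [_ _ ->|j jn _ [x Wx [y [_ Uy] <-]]]; first exact: nbhs0_0.
apply: UV => //; apply: (WU j) => //.
by apply: iterated_sumS Wx => ? [].
Qed.

End NeighborhoodsOfZero.

Section Folner.
Variable A : topologicalZmodType.
Implicit Types (V : set A) (S P : {fset A}).

(** For k > 0: at most a fraction 1/k of the points of P leave P under translation by s. *)
Definition almost_invariant (k : nat) P (s : A) :=
  (k * #|` P| <= k * \sum_(x <- P | (x + s)%R \in P) 1 + #|` P|)%N.

(** If p grew by more than p j / k at each of the k C steps, each step would add more
than p 0 / k, for a total of more than C p 0. *)
Lemma slow_growth (p : nat -> nat) (k C : nat) : (0 < k)%N ->
  (p (k * C) <= C * p 0)%N -> (forall j, p j <= p j.+1)%N ->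
  (0 < C)%N ->
  exists2 j, (j < k * C)%N & (k * p j.+1 <= k * p j + p j)%N.
Proof.
move=> k0 pC pS C0; apply: contrapT => no.
have fast j : (j <= k * C -> k * p 0 + j * (p 0).+1 <= k * p j)%N.
  elim: j => [|j IH] jC; first by rewrite mul0n addn0.
  have p0j : (p 0 <= p j)%N by elim: (j) => [//|i Hi]; exact: leq_trans Hi (pS i).
  have step : (k * p j + p j < k * p j.+1)%N.
    by rewrite ltnNge; apply/negP => h; apply: no; exists j.
  have := IH (ltnW jC); rewrite mulSn; lia.
have := fast _ (leqnn _); nia.
Qed.

Lemma almost_invariant_grow (k : nat) P P' s :
  {subset P <= P'} -> (forall x, x \in P -> x + s \in P') ->
  (k * #|` P'| <= k * #|` P| + #|` P|)%N -> almost_invariant k P s.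
Proof.
move=> sub shift grow; rewrite /almost_invariant.
have cardP : (#|` P| = \sum_(x <- P | (x + s)%R \in P) 1 +
   \sum_(x <- P | (x + s)%R \notin P) 1)%N.
  by rewrite -sum1_size (bigID (fun x => x + s \in P)).
have out : (#|` P| + \sum_(x <- P | (x + s)%R \notin P) 1 <= #|` P'|)%N.
  rewrite sum1_count -size_filter -(size_map (+%R^~ s) [seq _ <- _ | _]) -size_cat.
  apply: uniq_leq_size.
    have uP : uniq P by exact: fset_uniq.
    rewrite cat_uniq uP (map_inj_uniq (@addIr _ s)) filter_uniq // andbT /=.
    by apply/hasPn => _ /mapP[x + ->]; rewrite mem_filter => /andP[].
  move=> x; rewrite mem_cat => /orP[/sub//|/mapP[y + ->]].
  by rewrite mem_filter => /andP[_ /shift].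
nia.
Qed.

(** A box can be chosen that barely grows, for pair counting, when its size
increases by n; some center z must then be as good as the average one. *)
Lemma exists_box_center (S : seq A) V V1 (C n : nat) :
  (forall B : seq A, pair_count V B <= C * pair_count V1 B)%N -> V1 0 ->
  exists N z, z \in box N S /\
   (near_count V (undup (box (N + n) S)) z <= 2 * C * near_count V1 (undup (box N S)) z)%N.
Proof.
move=> VC V10; pose B N := undup (box N S).
have sizeB N : (size (B N) <= N.+1 ^ size S)%N by rewrite -size_box size_undup.
(* Pairs are at most quadratic in the size of the box, whence the exponent. *)
have [N wN] : exists N, (pair_count V1 (B (N + n)%N) <= 2 * pair_count V1 (B N))%N.
  apply: (@slow_step _ _ (size S + size S)).
    have B00 : 0 \in B 0%N by rewrite mem_undup box0.
    rewrite /pair_count (big_rem 0) //= /near_count (big_rem 0) //= subrr.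
    by move/asboolP: V10 => ->.
  move=> N; rewrite expnD.
  apply: leq_trans _ (leq_mul (sizeB N) (sizeB N)).
  rewrite -sum1_size big_distrl; apply: leq_sum => z _ /=.
  by rewrite mul1n; apply: leq_sum => y _; case: asboolP.
exists N; apply: contrapT => /forallNP no.
have lt z : z \in B N ->
    (2 * C * near_count V1 (B N) z < near_count V (B (N + n)%N) z)%N.
  move=> zB; rewrite ltnNge; apply/negP => h; apply: (no z); split=> //.
  by rewrite -mem_undup.
have sumlt : (2 * C * pair_count V1 (B N) < \sum_(z <- B N) near_count V (B (N + n)%N) z)%N.
  have B00 : 0 \in B N by rewrite mem_undup box0.
  rewrite /pair_count big_distrr /= (big_rem 0) //= [X in (_ < X)%N](big_rem 0) //=.
  rewrite -addSn; apply: leq_add; first exact: lt.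
  rewrite big_seq [leqRHS]big_seq; apply: leq_sum => z /mem_rem zB; exact/ltnW/lt.
have sub : (\sum_(z <- B N) near_count V (B (N + n)%N) z <= pair_count V (B (N + n)%N))%N.
  apply: uniq_sub_le_big; rewrite ?undup_uniq //; first by move=> *; exact: leq_addr.
  by move=> z; rewrite !mem_undup; apply: box_mono; exact: leq_addr.
have := VC (B (N + n)%N); nia.
Qed.

Lemma near_count_size V (B : seq A) z :
  near_count V B z = size [seq y <- B | `[< V (y - z) >]].
Proof.
rewrite size_filter -sum1_count big_mkcond /near_count.
by apply: eq_bigr => y _; case: `[< _ >].
Qed.

(** Start from the trace of a box on a V1-neighborhood of a good center and add S
repeatedly.  For n steps the sets stay inside a fixed neighborhood Va of the
center, because the elements of S are so small that n of them add up to an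
element of V1; so their cardinalities stay below C times the first one, and C
is determined by Va and V1 before n is.  For n large enough one of the steps
hardly increases the cardinality. *)
Theorem local_folner V (k : nat) :
  locally_group_precompact A -> nbhs 0 V -> (0 < k)%N ->
  exists W : set A, nbhs 0 W /\ forall S, (forall s, s \in S -> W s) ->
    exists P, [/\ P != fset0, forall x, x \in P -> V x &
      forall s, s \in S -> almost_invariant k P s].
Proof.
move=> [U U0 Upre] V0 k0.
have [Va [Va0 Vasym VaV]] := nbhs0_symmetric_half (filterI U0 V0).
have sVa : Va `<=` U `&` V.
  by move=> x Vx; rewrite -[x]addr0; apply: VaV => //; exact: nbhs0_0.
have [V1 [V10 V1sym V1Va]] := nbhs0_symmetric_half Va0.
have [V2 [V20 V2sym V2V1]] := nbhs0_symmetric_half V10.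
have [Q [Q0 Qsym QV2]] := nbhs0_symmetric_half V20.
have [_ /finite_fsetP[F ->] UF] := Upre Q Q0.
have cover B : (pair_count Va B <= 2 * size F * pair_count V1 B)%N.
  apply: (@pair_count_cover _ Q V2) => //.
  - by move=> a b Qa Qb; apply: QV2 => //; exact: Qsym.
  - by move=> a b Va' Vb; apply: V2V1 => //; exact: V2sym.
  - exact: nbhs0_0.
  - move=> v /sVa[/UF [f fF [q Qq <-]] _]; exists f => //.
    by rewrite addrAC subrr add0r.
set C := (2 * (2 * size F))%N.
have [W [W0 WV1]] := nbhs0_iterated (k * C.+1) V10.
exists W; split=> // S SW.
have [N [z [zB zcount]]] := exists_box_center S (k * C.+1) cover (nbhs0_0 V10).
pose P0 := [fset x in [seq y - z | y <- undup (box N S) & `[< V1 (y - z) >]]]%fset.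
pose P j := iter j (fun P => P `|` [fset (x + s)%R | x in P, s in S])%fset P0.
have PS j : {subset P j <= P j.+1} by move=> x Px; rewrite /P iterS inE Px.
have Pshift j x s : s \in S -> x \in P j -> x + s \in P j.+1.
  by move=> sS Px; rewrite /P iterS inE; apply/orP; right; apply/imfset2P; exists x => //; exists s.
have Pin j x : x \in P j -> x + z \in box (N + j) S /\
    exists2 y, V1 y & iterated_sum W j (x - y).
  elim: j x => [|j IH] x.
    rewrite inE => /mapP[y]; rewrite mem_filter mem_undup => /andP[/asboolP Vy yB] ->.
    by rewrite subrK addn0; split=> //; exists (y - z) => //; rewrite subrr.
  rewrite /P iterS inE => /orP[/IH [xB [y Vy Wxy]]|].
    split; first by apply: box_mono xB; rewrite addnS.
    by exists y => //; exists (x - y) => //; exists 0; [exact: nbhs0_0|rewrite addr0].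
  case/imfset2P => x' /= /IH [xB [y Vy Wxy]] [s /= sS ->]; split.
    by rewrite addrAC addnS box_translate.
  exists y => //; exists (x' - y) => //; exists s; first exact: SW.
  by rewrite addrAC.
have PVa j x : (j <= k * C.+1)%N -> x \in P j -> Va x.
  move=> jn /Pin [_ [y Vy Wxy]]; rewrite -[x](subrK y).
  by apply: V1Va => //; exact: WV1 Wxy.
have cP0 : #|` P 0%N| = near_count V1 (undup (box N S)) z.
  rewrite near_count_size card_fseq undup_id ?size_map //.
  by rewrite map_inj_uniq ?filter_uniq ?undup_uniq //; exact: addIr.
have cPn : (#|` P (k * C.+1)%N| <= near_count Va (undup (box (N + k * C.+1) S)) z)%N.
  rewrite near_count_size -(size_map (+%R^~ z)); apply: uniq_leq_size.
    by rewrite map_inj_uniq ?fset_uniq //; exact: addIr.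
  move=> _ /mapP[x xP ->]; rewrite mem_filter mem_undup addrK.
  have [-> _] := Pin _ _ xP; rewrite andbT; apply/asboolP.
  exact: PVa xP.
have [j jn grow] : exists2 j, (j < k * C.+1)%N &
    (k * #|` P j.+1| <= k * #|` P j| + #|` P j|)%N.
  apply: (@slow_growth (fun j => #|` P j|)) => //.
  - rewrite cP0; apply: leq_trans cPn _; apply: leq_trans zcount _.
    by rewrite leq_mul2r leqnSn orbT.
  - by move=> j; apply: uniq_leq_size (fset_uniq _) (@PS j).
exists (P j); split.
- have P00 : 0 \in P 0%N.
    rewrite inE; apply/mapP; exists z; last by rewrite subrr.
    rewrite mem_filter mem_undup zB subrr andbT; apply/asboolP.
    exact: nbhs0_0 V10.
  have : 0 \in P j by elim: (j) => [//|i /PS].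
  by apply: contraTneq => ->; rewrite inE.
- by move=> x /(PVa _ _ (ltnW jn))/sVa[].
- move=> s sS; apply: (almost_invariant_grow _ _ grow); first exact: PS.
  by move=> x; exact: Pshift.
Qed.

End Folner.

(** * Characters close to an approximate local homomorphism *)

Section FiniteStage.
Variables (R : realType) (A : topologicalZmodType).
Implicit Types (V W : set A) (tau psi : A -> circle R).

Lemma exists_le_average (P : {fset A}) (p : pred A) (g : A -> R) (b : R) :
  P != fset0 -> (forall x, 0 <= g x) ->
  (#|` P| <= 2 * \sum_(x <- P | p x) 1)%N ->
  \sum_(x <- P | p x) g x <= b * #|` P|%:R -> exists2 x, p x & g x <= 2 * b.
Proof.
move=> P0 g0 half avg; apply: contrapT => no.
have lt x : p x -> 2 * b < g x.
  by move=> px; rewrite ltNge; apply/negP => h; apply: no; exists x.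
have b0 : 0 <= b.
  have : 0 <= b * #|` P|%:R by apply: le_trans avg; rewrite sumr_ge0.
  by rewrite pmulr_lge0 // ltr0n cardfs_gt0.
have cP : (0 < #|` P|)%N by rewrite cardfs_gt0.
have hs : has p P.
  apply/negPn/negP => hno; move: half.
  by rewrite big_hasC // muln0 leqNgt cP.
have : \sum_(x <- P | p x) (2 * b) < \sum_(x <- P | p x) g x.
  exact: ltr_sum.
have -> : \sum_(x <- P | p x) (2 * b) = 2 * b * (\sum_(x <- P | p x) 1)%N%:R.
  by rewrite natr_sum mulr_sumr; apply: eq_bigr => x _; rewrite mulr1.
have : #|` P|%:R <= 2 * (\sum_(x <- P | p x) 1)%N%:R :> R by rewrite -natrM ler_nat.
move: (_%:R) (_%:R) avg => q c; nra.
Qed.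

(** The finite set Y is chosen after P and is almost invariant under P, which is
half-invariant under S.  For s0 in S at least half of the s in P have s + s0 in P,
and for one of these tau and psi are close both at s and at s + s0. *)
Lemma characters_near_local_hom V tau (n : nat) :
  locally_group_precompact A -> nbhs 0 V -> (0 < n)%N ->
  (forall x y, V x -> V y -> V (x + y) ->
     1 - cs (tau (x + y) - tau x - tau y) <= n%:R^-1) ->
  exists W : set A, nbhs 0 W /\ forall S : {fset A}, (forall s, s \in S -> W s) ->
    exists psi, GRing.zmod_morphism psi /\
      forall s, s \in S -> 1 - cs (psi s - tau s) <= 36 / n%:R.
Proof.
move=> preA V0 n0 htau.
have [Vh [Vh0 _ VhV]] := nbhs0_symmetric_half V0.
have VhsV : Vh `<=` V.
  by move=> x Vx; rewrite -[x]addr0; apply: VhV => //; exact: nbhs0_0.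
have [V1 [V10 folner1]] := local_folner preA Vh0 n0.
have [V2 [V20 _ V21]] := nbhs0_symmetric_half (filterI Vh0 V10).
have V2s : V2 `<=` Vh `&` V1.
  by move=> x Vx; rewrite -[x]addr0; apply: V21 => //; exact: nbhs0_0.
have [V3 [V30 folner2]] := local_folner preA V20 (ltn0Sn 1).
exists (V2 `&` V3); split=> [|S SW]; first exact: filterI.
have [|P [P0 PV2 Pinv]] := folner2 S; first by move=> s /SW[].
have [|Y [Y0 YVh Yinv]] := folner1 P; first by move=> s /PV2/V2s[].
have n0' : 0 < n%:R :> R by rewrite ltr0n.
have nV : 0 < (n%:R : R)^-1 by rewrite invr_gt0.
have [|psi [hpsi psiP]] := @character_near_on_average R A tau Y P (2 / n%:R) Y0.
  move=> s sP.
  have cnt : (1 - n%:R^-1) * #|` Y|%:R <=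
      (\sum_(x <- Y | (x + s)%R \in Y) 1)%N%:R :> R.
    have : (n * #|` Y| <= n * \sum_(x <- Y | (x + s)%R \in Y) 1 + #|` Y|)%N := Yinv s sP.
    rewrite -(ler_nat R) natrD !natrM -(ler_pM2l nV).
    by rewrite mulrDr !mulrA mulVf ?gt_eqF // !mul1r; lra.
  have : (1 - n%:R^-1) * (\sum_(x <- Y | (x + s)%R \in Y) 1)%N%:R <=
      \sum_(y <- Y | y + s \in Y) cs (tau (y + s) - tau y - tau s).
    rewrite natr_sum mulr_sumr big_seq_cond [leRHS]big_seq_cond.
    apply: ler_sum => y /andP[yY ysY]; rewrite mulr1.
    have [Vhs _] := V2s _ (PV2 s sP).
    have := htau y s (VhsV _ (YVh _ yY)) (VhsV _ Vhs) (VhV _ _ (YVh _ yY) Vhs); lra.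
  have n1 : n%:R^-1 <= 1 :> R by rewrite invf_le1 // ler1n.
  have e1 : 0 <= 1 - n%:R^-1 :> R by rewrite subr_ge0.
  have a0 : 0 <= n%:R^-1 * (n%:R^-1 * #|` Y|%:R) :> R by rewrite !mulr_ge0 // ltW.
  have := ler_wpM2l e1 cnt; lra.
exists psi; split=> // s0 s0S.
pose D (x : A) : R := 1 - cs (psi x - tau x).
have D0 x : 0 <= D x by rewrite subr_ge0 cs_le1.
have sum_left : \sum_(s <- P | s + s0 \in P) D s <= \sum_(s <- P) D s.
  by rewrite [leRHS](bigID (fun s => s + s0 \in P)) /= lerDl sumr_ge0.
have sum_right : \sum_(s <- P | s + s0 \in P) D (s + s0) <= \sum_(s <- P) D s.
  rewrite [leRHS](bigID (fun s => s - s0 \in P)) /= -big_filter.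
  rewrite -(big_map (+%R^~ s0) xpredT D) -[X in _ <= X + _]big_filter.
  rewrite (perm_big [seq y <- P | y - s0 \in P]) ?lerDl ?sumr_ge0 //.
  apply: uniq_perm; rewrite ?(map_inj_uniq (@addIr _ s0)) ?filter_uniq ?fset_uniq //.
  move=> y; rewrite mem_filter; apply/mapP/andP => [[x + ->]|[ysP yP]].
    by rewrite mem_filter addrK => /andP[].
  by exists (y - s0); rewrite ?mem_filter subrK // yP.
have [|||s /andP[sP ssP] Ds] := @exists_le_average P
   (fun s => (s \in P) && (s + s0 \in P)) (fun s => D s + D (s + s0)) (4 / n%:R) P0.
- by move=> x; rewrite addr_ge0.
- rewrite -big_seq_cond; have := Pinv s0 s0S; rewrite /almost_invariant.
  by rewrite [(2 * #|` P|)%N]mul2n -addnn leq_add2r.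
- rewrite -big_seq_cond big_split /=.
  have : \sum_(s <- P) D s <= 2 / n%:R * #|` P|%:R := psiP.
  move: sum_left sum_right; lra.
have Vs0 : V s0 by have [/V2s[/VhsV]] := SW s0 s0S.
have Vs : V s by have [/VhsV] := V2s _ (PV2 s sP).
have Vss0 : V (s + s0) by have [/VhsV] := V2s _ (PV2 _ ssP).
have tau_s := htau s s0 Vs Vs0 Vss0.
(* The sum of the first two defects is at most 8/n and the third one is at most
   1/n; two uses of the quasi-triangle inequality give 4 * 8 + 4 = 36. *)
have -> : psi s0 - tau s0 = (psi (s + s0) - tau (s + s0)) +
    (- (psi s - tau s) + (tau (s + s0) - tau s - tau s0)).
  rewrite (zmod_morphismD _ _ hpsi) opprB.
  rewrite [RHS](AC (3*(2*3)) ((1*5)*(3*6)*(4*7)*(2*8))) /=.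
  by rewrite !subrr addNr !add0r.
have := cs_subadd (psi (s + s0) - tau (s + s0))
  (- (psi s - tau s) + (tau (s + s0) - tau s - tau s0)).
have := cs_subadd (- (psi s - tau s)) (tau (s + s0) - tau s - tau s0).
have := D0 s; have := D0 (s + s0); move: Ds tau_s; rewrite csN /D.
move: (n%:R^-1) => e; lra.
Qed.
End FiniteStage.

(** * Compactness *)

Lemma nbhs0_translate (A : topologicalZmodType) (t : A) (C : set A) :
  nbhs t C -> nbhs 0 [set s | C (s + t)].
Proof.
have : (fun s : A => (s, t)) @ (0 : A) --> ((0, t) : A * A).
  by apply: cvg_pair; [exact: cvg_id|exact: cvg_cst].
move=> /cvg_comp /(_ (@add_continuous A (0, t))); rewrite /= add0r; exact.
Qed.

Section Compactness.
Variable R : realType.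

Lemma cluster_le (T : topologicalType) (F : set_system T) (g : T -> R) a b :
  cluster F a -> {for a, continuous g} -> F [set x | g x <= b] -> g a <= b.
Proof.
move=> Fa ga Fb; rewrite leNgt; apply/negP => ba.
have [x [/= xb bx]] := Fa _ _ Fb (cvgr_gt _ ga _ ba).
by move: xb; rewrite leNgt => /negP.
Qed.

Lemma circle_of_coordinates (a b : R) : a ^+ 2 + b ^+ 2 = 1 ->
  exists t : circle R, cs t = a /\ sn t = b.
Proof.
move=> ab; suff n1 : `|Complex a b : (complex R)^o| == 1 by exists (Circle n1).
suff : `|Complex a b : complex R| == 1 by [].
by rewrite normc_def /= ab sqrtr1.
Qed.

(** A filter on the circle is pushed to the square [-1, 1]^2 by the coordinates;
a cluster point there lies on the unit circle by closedness. *)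
Lemma compact_circle : compact [set: circle R].
Proof.
move=> F FF _; pose coord (t : circle R) := (cs t, sn t).
pose Box := `[(-1 : R), 1] `*` `[(-1 : R), 1].
have cBox : compact Box by apply: compact_setX; exact: segment_compact.
have inBox t : Box (coord t).
  have := cs2Dsn2 t; have := sqr_ge0 (cs t); have := sqr_ge0 (sn t).
  by move=> s0 c0 cs1; split; rewrite /= in_itv /=; apply/andP; split; nra.
have [[a b] [_ ab]] := cBox (coord @ F) _ (filterS (fun t _ => inBox t) filterT).
have cont1 (p : R * R) : (fun q : R * R => q.1) @ p --> p.1 by exact: cvg_fst.
have cont2 (p : R * R) : (fun q : R * R => q.2) @ p --> p.2 by exact: cvg_snd.
have norm_cont : (fun q : R * R => q.1 * q.1 + q.2 * q.2) @ (a, b) --> a * a + b * b.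
  apply: cvgD; apply: cvgM; by [exact: (cont1 (a, b))|exact: (cont2 (a, b))].
have norm1 t : cs t * cs t + sn t * sn t = 1 by rewrite -!expr2 cs2Dsn2.
have le1 : a * a + b * b <= 1.
  apply: (cluster_le (g := fun q : R * R => q.1 * q.1 + q.2 * q.2) ab) => //.
  apply: (@filterS _ F _ setT); last exact: filterT.
  by move=> t _; rewrite /coord /= norm1.
have ge1 : - (a * a + b * b) <= - 1.
  apply: (cluster_le (g := fun q : R * R => - (q.1 * q.1 + q.2 * q.2)) ab).
    exact: cvgN.
  apply: (@filterS _ F _ setT); last exact: filterT.
  by move=> t _; rewrite /coord /= norm1.
have [|t [ta tb]] := @circle_of_coordinates a b.
  by apply/eqP; rewrite !expr2 eq_le; lra.
exists t; split=> // B C FB tC.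
have tC0 := nbhs0_translate tC.
have [e e0 eC] := cs_nbhs0 tC0.
have FB' : (coord @ F) (coord @` B) by apply: (@filterS _ F _ B) => // s Bs; exists s.
have dist_cont : (fun q : R * R => 1 - (q.1 * a + q.2 * b)) @ (a, b) -->
    1 - (a * a + b * b).
  apply: cvgB; first exact: cvg_cst.
  by apply: cvgD; apply: cvgMl; [exact: (cont1 (a, b))|exact: (cont2 (a, b))].
have near_ab : nbhs (a, b) [set q : R * R | 1 - (q.1 * a + q.2 * b) < e].
  by apply: (cvgr_lt _ dist_cont); lra.
have [_ [[s Bs <-] /= se]] := ab _ _ FB' near_ab.
exists s; split=> //; rewrite -[s](subrK t); apply: eC.
rewrite csD csN snN ta tb; lra.
Qed.

End Compactness.

Lemma cvg_sub (T : Type) (F : set_system T) (A : topologicalZmodType)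
    (u v : T -> A) (a b : A) : Filter F ->
  u @ F --> a -> v @ F --> b -> (fun x => u x - v x) @ F --> a - b.
Proof.
move=> FF ua vb.
have vb' : (fun x => - v x) @ F --> - b
  by apply: (@cvg_comp _ _ _ v -%R F _ _ vb); exact: opp_continuous.
apply: (@cvg_comp _ _ _ (fun x => (u x, - v x)) (fun q => q.1 + q.2) F _ _
  (cvg_pair ua vb')).
exact: (@add_continuous A (a, - b)).
Qed.

Lemma cvg_cs (T : Type) (F : set_system T) (R : realType) (u : T -> circle R) a :
  Filter F -> u @ F --> a -> (fun x => 1 - cs (u x)) @ F --> 1 - cs a.
Proof.
move=> FF ua; have cu : (fun x => cs (u x)) @ F --> cs a.
  by apply: (@cvg_comp _ _ _ u (@cs R) F _ _ ua); exact: cs_continuous.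
by apply: (@cvgB R R^o); [exact: cvg_cst|exact: cu].
Qed.

Section Limit.
Variables (R : realType) (A : zmodType).
Implicit Types (tau psi : A -> circle R).

Lemma cs_eq1 (t : circle R) : cs t = 1 -> t = 0.
Proof.
move=> c1; have := cs2Dsn2 t; rewrite c1 => s1.
have s0 : sn t = 0 by apply/eqP; rewrite -sqrf_eq0; apply/eqP; lra.
by apply: val_inj; move: c1 s0; rewrite /cs /sn /=; case: (circle_val t) => a b /= -> ->.
Qed.

(** The functions chosen for the finite subsets of W have, along the directed set
of finite sets, a cluster point for pointwise convergence; both being a
homomorphism and the inequalities on W are closed conditions on the values at
finitely many points. *)
Lemma character_near_of_finite (W : set A) tau (b : R) :
  (forall S : {fset A}, (forall s, s \in S -> W s) ->
    exists psi, GRing.zmod_morphism psi /\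
      forall s, s \in S -> 1 - cs (psi s - tau s) <= b) ->
  exists psi, GRing.zmod_morphism psi /\
    forall s, W s -> 1 - cs (psi s - tau s) <= b.
Proof.
move=> fin.
have /choice [Psi PsiP] : forall S : {fset A}, exists psi,
    GRing.zmod_morphism psi /\
    forall s, s \in S -> W s -> 1 - cs (psi s - tau s) <= b.
  move=> S; have [|psi [hpsi near]] := fin [fset s in S | `[< W s >]]%fset.
    by move=> s; rewrite !inE => /andP[_ /asboolP].
  exists psi; split=> // s sS Ws; apply: near.
  by rewrite !inE sS; apply/asboolP.
pose base := filter_from [set: {fset A}] (fun S => [set T | (S `<=` T)%fset]).
have base_proper : ProperFilter base.
  apply: filter_from_proper; last by move=> S _; exists S => /=.
  apply: filter_from_filter; first by exists fset0.
  move=> S T _ _; exists (S `|` T)%fset => // U /=.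
  by rewrite fsubUset => /andP.
pose X := prod_topology (fun _ : A => circle R).
have cX : compact [set f : X | forall i, [set: circle R] (f i)].
  exact: (@tychonoff A (fun=> circle R) (fun=> setT) (fun=> @compact_circle R)).
have [f [_ fcl]] := cX ((Psi : {fset A} -> X) @ base) _ (filterS (fun _ _ _ => I) filterT).
have ev (g : X -> R) (c : R) (S : {fset A}) : {for f, continuous g} ->
    (forall T, (S `<=` T)%fset -> g (Psi T) <= c) -> g f <= c.
  by move=> gf gS; apply: (cluster_le fcl gf); exists S.
have proj_cont x : (fun g : X => g x) @ f --> f x := @proj_continuous _ _ x f.
exists f; split=> [x y|s Ws].
  apply/subr0_eq/cs_eq1/eqP; rewrite eq_le cs_le1 -subr_le0.
  apply: (ev (fun g => 1 - cs (g (x - y) - (g x - g y))) 0 fset0).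
    apply: (@cvg_cs _ (nbhs f)); apply: cvg_sub; first exact: proj_cont.
    by apply: cvg_sub; exact: proj_cont.
  by move=> T _; have [h _] := PsiP T; rewrite h subrr subrr.
apply: (ev (fun g => 1 - cs (g s - tau s)) b [fset s]%fset).
  apply: (@cvg_cs _ (nbhs f)); apply: cvg_sub; first exact: proj_cont.
  exact: cvg_cst.
by move=> T; rewrite fsub1set => sT; have [_] := PsiP T; apply.
Qed.

End Limit.

(** * Continuity of characters bounded near 0 *)

Section Continuity.
Variables (R : realType) (A : topologicalZmodType).

(** 1 - cos 2x = 2 (1 - cos x) (1 + cos x), and cos x >= 1/2 here. *)
Lemma one_sub_cs_double (t : circle R) :
  1 - cs t <= 1 / 2 -> 3 * (1 - cs t) <= 1 - cs (t + t).
Proof.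
rewrite csD; have := cs2Dsn2 t; have := cs_le1 t; nra.
Qed.

Lemma one_sub_cs_pow n (t : circle R) :
  (forall j, (j <= n)%N -> 1 - cs (t *+ 2 ^ j) <= 1 / 2) ->
  3 ^+ n * (1 - cs t) <= 1 / 2.
Proof.
elim: n t => [|n IH] t small; first by rewrite expr0 mul1r; apply: (small 0%N).
have t2 : 1 - cs t <= 1 / 2 by apply: (small 0%N).
have /IH : forall j, (j <= n)%N -> 1 - cs ((t + t) *+ 2 ^ j) <= 1 / 2.
  by move=> j jn; rewrite -mulr2n -mulrnA -expnS; exact: small.
apply: le_trans; rewrite exprSr -mulrA ler_wpM2l ?exprn_ge0 //.
exact: one_sub_cs_double.
Qed.

Lemma iterated_sum_mulrn (W : set A) x n : W x -> iterated_sum W n (x *+ n).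
Proof.
move=> Wx; elim: n => [|n IH]; first by rewrite mulr0n.
by exists (x *+ n) => //; exists x => //; rewrite -mulrSr.
Qed.

(** The defect at least triples under doubling while it is at most 1/2, so it is at
most 3^-n / 2 at the points whose doubles, up to the n-th, remain in U. *)
Lemma character_continuous (chi : A -> circle R) (U : set A) :
  GRing.zmod_morphism chi -> nbhs 0 U ->
  (forall x, U x -> 1 - cs (chi x) <= 1 / 2) -> continuous chi.
Proof.
move=> hchi U0 Uchi x C xC.
have C0 : nbhs 0 [set s | C (s + chi x)] by exact: nbhs0_translate.
have [e e0 eC] := cs_nbhs0 C0.
have [n ne] : exists n, e^-1 < n%:R.
  by exists (Num.bound e^-1); apply: archi_boundP; rewrite invr_ge0 ltW.
have [W [W0 WU]] := nbhs0_iterated (2 ^ n) U0.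
have Wx : nbhs x [set y | W (y - x)].
  have : (fun y : A => y - x) @ x --> x - x.
    by apply: (@cvg_sub _ (nbhs x) A id (fun=> x)); [exact: cvg_id|exact: cvg_cst].
  by rewrite subrr; apply.
apply: filterS Wx => y /= Wyx; rewrite -[chi y](subrK (chi x)) -hchi; apply: eC.
have small : 3 ^+ n * (1 - cs (chi (y - x))) <= 1 / 2.
  apply: one_sub_cs_pow => j jn.
  have -> : chi (y - x) *+ 2 ^ j = chi ((y - x) *+ 2 ^ j).
    elim: (2 ^ j)%N => [|m IH]; first by rewrite !mulr0n zmod_morphism0.
    by rewrite !mulrS IH (zmod_morphismD (y - x) _ hchi).
  apply: Uchi; apply: (WU (2 ^ j)%N); last exact: iterated_sum_mulrn.
  by rewrite leq_exp2l.
have n3 : e^-1 < 3 ^+ n.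
  apply: lt_le_trans ne _; rewrite -natrX ler_nat; exact/ltnW/ltn_expl.
have d0 : 0 <= 1 - cs (chi (y - x)) by rewrite subr_ge0 cs_le1.
have en : 1 < 3 ^+ n * e by rewrite -ltr_pdivrMr // div1r.
have p3 : 0 < 3 ^+ n :> R by rewrite exprn_gt0.
rewrite -(ltr_pM2l p3); lra.
Qed.

End Continuity.

(** * Splitting of the extensions by the circle *)

Theorem theorem2p14 (R : realType) (G : topologicalZmodType) :
  hausdorff_space G -> locally_group_precompact G -> S_TG (circle R) G.
Proof.
move=> _ preG X i p [i_inj ker_p p_surj _ cp i_open p_open].
have pi0 t : p (i t) = 0.
  have : range i (i t) by exists t.
  by rewrite ker_p.
have ker x : p x = 0 -> exists t, i t = x.
  move=> px; have : [set x | p x = 0] x by [].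
  by rewrite -ker_p => -[t _ <-]; exists t.
have [chi0 [hchi0 chi0i]] : exists chi0 : X -> circle R,
    GRing.zmod_morphism chi0 /\ forall t, chi0 (i t) = t.
  have graph : @partial_hom X (circle R) [set u | u.1 = i u.2].
    split=> [|u v /= -> ->|d /= d0]; first by rewrite /= raddf0.
      by rewrite raddfB.
    by apply: i_inj; rewrite raddf0.
  have [chi0 [h e]] := hom_extension (@circle_divisible R) graph.
  by exists chi0; split=> // t; apply: e.
(* With local errors 1/n, the final bound on the defect of chi is
   2 (1/n) + 2 (36/n) = 74/n, which has to be at most 1/2. *)
have e0 : 0 < (148%:R : R)^-1 by rewrite invr_gt0.
have [V V0 Vsmall] : exists2 V : set X, nbhs 0 V &
    forall t, V (i t) -> 1 - cs t <= 148%:R^-1.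
  have oU : open [set t : circle R | 1 - 148%:R^-1 < cs t].
    apply: (@open_comp _ _ (@cs R) [set r | 1 - 148%:R^-1 < r]); last exact: open_gt.
    by move=> t _; exact: cs_continuous.
  have [V oV iV] := i_open _ oU; exists V.
    apply: open_nbhs_nbhs; split=> //.
    have : (V `&` range i) 0.
      by rewrite -iV; exists 0; rewrite ?raddf0 //= cs0; lra.
    by case.
  move=> t Vt; have : (V `&` range i) (i t) by split=> //; exists t.
  by rewrite -iV => -[s /= sU /i_inj <-]; lra.
have [Va [Va0 Vasym VaV]] := nbhs0_symmetric_half V0.
have [Vb [Vb0 Vbsym VbVa]] := nbhs0_symmetric_half Va0.
have VbsVa x : Vb x -> Va x.
  by move=> Vx; rewrite -[x]addr0; apply: VbVa => //; exact: nbhs0_0.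
have [O [oO O0] OVb] : exists2 O : set X, open_nbhs 0 O & O `<=` Vb.
  by move: Vb0; rewrite nbhsE => -[O]; exists O.
pose pO := p @` O.
have pO0 : nbhs 0 pO.
  have [V' oV' pOV'] := p_open _ oO.
  apply: open_nbhs_nbhs; split; last by exists 0; rewrite ?raddf0.
  by rewrite /pO pOV' p_surj setIT.
have /choice [sec secP] : forall v, exists x, pO v -> O x /\ p x = v.
  move=> v; have [[x Ox xv]|no] := pselect (pO v); first by exists x.
  by exists 0.
pose tau v := chi0 (sec v).
(* The defect of additivity of sec is an element of T close to 0 in X, and chi0
   is the identity on T. *)
have tau_hom u v : pO u -> pO v -> pO (u + v) ->
    1 - cs (tau (u + v) - tau u - tau v) <= 148%:R^-1.
  move=> /secP[Ou pu] /secP[Ov pv] /secP[Ouv puv].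
  have [|t tE] := ker (sec (u + v) - sec u - sec v).
    by rewrite !raddfB /= puv pu pv addrAC addrK subrr.
  rewrite /tau -!hchi0 -tE chi0i; apply: Vsmall; rewrite tE -addrA.
  apply: VaV; first exact/VbsVa/OVb.
  by apply: VbVa; apply/Vbsym/OVb.
have [W [W0 finW]] := characters_near_local_hom preG pO0 (isT : (0 < 148)%N) tau_hom.
have [psi [hpsi psi_tau]] := character_near_of_finite finW.
pose chi x := chi0 x - psi (p x).
have hchi : GRing.zmod_morphism chi.
  move=> x y; rewrite /chi raddfB hchi0 hpsi !opprB.
  by rewrite (AC (2*2) (1*4*(3*2))).
have chi_i t : chi (i t) = t by rewrite /chi pi0 chi0i zmod_morphism0 // subr0.
have chi_cont : continuous chi.
  have WO : nbhs 0 (p @^-1` (W `&` pO)).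
    by apply: cp; rewrite raddf0; exact: filterI.
  have OO : nbhs 0 O by exact: open_nbhs_nbhs.
  apply: (character_continuous hchi (filterI OO WO)) => x [Ox [Wpx pOpx]].
  have [Osec psec] := secP _ pOpx.
  have [|t tE] := ker (x - sec (p x)); first by rewrite raddfB /= psec subrr.
  have t_small : 1 - cs t <= 148%:R^-1.
    apply: Vsmall; rewrite tE; apply: VaV; first exact/VbsVa/OVb.
    exact/VbsVa/Vbsym/OVb.
  (* x differs from the section over its image by an element t of T. *)
  have -> : chi x = t + - (psi (p x) - tau (p x)).
    have -> : t = chi0 x - tau (p x) by rewrite -[t]chi0i tE hchi0.
    by rewrite opprB addrA subrK.
  have := cs_subadd t (- (psi (p x) - tau (p x))); rewrite csN.
  have := psi_tau _ Wpx; lra.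
pose Phi x := (chi x, p x).
have hPhi : GRing.zmod_morphism Phi.
  by move=> x y; congr (_, _); [exact: hchi|exact: raddfB].
pose PhiA : {additive X -> circle R * G} :=
  HB.pack Phi (GRing.isZmodMorphism.Build X (circle R * G)%type Phi hPhi).
exists PhiA; split.
- by move=> x; exact: (cvg_pair (chi_cont x) (cp x)).
- by move=> t; rewrite /= /Phi chi_i pi0.
- by [].
Qed.
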